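(* Let $\Lambda^U(\lambda)$ be the monic block characteristic polynomial of $A_j^{U,Z}$ with respect to $E_1R_B$. Then, for every $z\in\mathbb C$ that is not an eigenvalue of $A_j^{U,Z}$, the residual $\mathrm{Res}_{B,j}(z)=B-(zI-A)X_{B,j}(z)$ of the Petrov-Galerkin approximation $X_{B,j}(z)=\mathbf U_j(zI-A_j^{U,Z})^{-1}E_1R_B$ satisfies $$\mathrm{Res}_{B,j}(z)=\varphi(z)\,\varphi(A)^{-1}\left(\Lambda^U(A)\circ B\right)\Lambda^U(z)^{-1}.$$
   Context: Let $A\in\mathbb C^{n\times n}$, $B\in\mathbb C^{n\times s}$ with $s>1$, $j\ge 1$, and shifts $\Sigma=\{\sigma_1,\dots,\sigma_{j-1}\}\subset\mathbb C\cup\{\infty\}$, the finite ones not eigenvalues of $A$. Put $\varphi(z)=\prod_{\sigma_i\neq\infty}(z-\sigma_i)$ and $E_i=e_i\otimes I_s$ (size clear from the context). For an $s\times s$ matrix polynomial $P(\lambda)=\sum_i\lambda^iP_i$ and a block vector $W$ with $s$ columns, $P(N)\circ W:=\sum_iN^iWP_i$. Block rational Krylov spaces: $\mathcal{RK}^\square_j(A,B,\Sigma)=\{\varphi(A)^{-1}(P(A)\circ B):\deg P<j\}$ and $\mathcal{RK}^\square_{j+1}(A,B,\Sigma)=\{\varphi(A)^{-1}(P(A)\circ B):\deg P\le j\}$ (last pole at infinity). Standing assumptions. The block rational Arnoldi procedure for $\mathcal{RK}^\square_{j+1}(A,B,\Sigma)$ runs without breakdown or deflation (every generated block has full rank $s$),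 with the last pole at infinity. It gives a matrix with orthonormal columns $\mathbf U_{j+1}=[U_1,\dots,U_{j+1}]$, $U_i\in\mathbb C^{n\times s}$, such that $\mathcal{RK}^\square_m(A,B,\Sigma)=\{\sum_{i\le m}U_iC_i: C_i\in\mathbb C^{s\times s}\}$ for $m=j,j+1$, and $B=U_1R_B$ with $R_B\in\mathbb C^{s\times s}$ invertible. Let $\mathbf U_j=[U_1,\dots,U_j]$, and let $\mathbf Z_j\in\mathbb C^{n\times js}$ have orthonormal columns with $\mathbf Z_j^*\mathbf U_j$ invertible. Put $A_j^{U,Z}=(\mathbf Z_j^*\mathbf U_j)^{-1}\mathbf Z_j^*A\mathbf U_j$. The finite shifts $\sigma_i$ are not eigenvalues of $A_j^{U,Z}$. A block characteristic polynomial of $N\in\mathbb C^{js\times js}$ with respect to $W\in\mathbb C^{js\times s}$ is an $s\times s$ matrix polynomial $P$ of degree $j$ with $P(N)\circ W=0$; it is monic if its leading coefficient is $I_s$. In the present setting the monic block characteristic polynomial of $A_j^{U,Z}$ with respect to $E_1R_B$ exists and is unique. *)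

(* Defs.v *)
From HB Require Import structures.
From mathcomp Require Import all_boot all_order all_algebra.

Set Implicit Arguments.
Unset Strict Implicit.
Unset Printing Implicit Defensive.

Import GRing.Theory Num.Theory.
Local Open Scope ring_scope.
Local Open Scope sesquilinear_scope.

(* Block vectors have block size s.+1 so that 'M[C]_s.+1 is a nontrivial ring
   and s.+1 x s.+1 matrix polynomials are elements P of {poly 'M[C]_s.+1}:
   deg P <= d is [size P <= d.+1], and P(z) is [P.[z%:M]].
   A block matrix with m block columns (rows) of size s.+1 has
   \sum_(i < m) s.+1 columns (rows), and blocks are numbered from 0. *)

(* P(N) o W *)
Definition mpoly_circ (C : fieldType) (m s : nat) (P : {poly 'M[C]_s.+1})
    (N : 'M[C]_m) (W : 'M[C]_(m, s.+1)) : 'M[C]_(m, s.+1) :=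
  \sum_(i < size P) N ^+ i *m W *m P`_i.

(* e_i (x) I_(s.+1), with m blocks *)
Definition blockE (C : fieldType) (s m i : nat) :
    'M[C]_(\sum_(k < m) s.+1, s.+1) :=
  \mxcol_(k < m) ((val k == i)%:R%:M : 'M[C]_s.+1).

(* A shift is None when it is infinite. *)
Definition phi (C : fieldType) (l : nat) (sigma : 'I_l -> option C) :
    {poly C} :=
  \prod_(i < l) if sigma i is Some a then 'X - a%:P else 1.

(* V lies in { phi(A)^-1 (P(A) o B) : deg P < d }.
   An additional infinite last pole leaves phi unchanged, so d = j and d = j.+1
   with the same j.-1 shifts give the two block rational Krylov spaces. *)
Definition in_block_RK (C : fieldType) (n s l d : nat) (A : 'M[C]_n.+1)
    (B : 'M[C]_(n.+1, s.+1)) (sigma : 'I_l -> option C)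
    (V : 'M[C]_(n.+1, s.+1)) : Prop :=
  exists P : {poly 'M[C]_s.+1},
    (size P <= d)%N /\ V = invmx (horner_mx A (phi sigma)) *m mpoly_circ P A B.

Definition in_block_span (C : fieldType) (n s m : nat)
    (U : 'I_m -> 'M[C]_(n, s.+1)) (V : 'M[C]_(n, s.+1)) : Prop :=
  exists K : 'I_m -> 'M[C]_s.+1, V = \sum_(i < m) U i *m K i.

Definition firstblocks (C : fieldType) (n s j : nat)
    (U : 'I_j.+1 -> 'M[C]_(n, s.+1)) (i : 'I_j) : 'M[C]_(n, s.+1) :=
  U (widen_ord (leqnSn j) i).

Definition orthonormal_cols (C : numClosedFieldType) (n m : nat)
    (V : 'M[C]_(n, m)) : Prop := V ^t* *m V = 1%:M.

(* (Z^* U)^-1 Z^* A U *)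
Definition compression (C : numClosedFieldType) (n m : nat)
    (A : 'M[C]_n) (U Z : 'M[C]_(n, m)) : 'M[C]_m :=
  invmx (Z ^t* *m U) *m (Z ^t* *m A *m U).

(* U (zI - N)^-1 W, with W = E_1 R_B and N the compression of A *)
Definition pg_approx (C : fieldType) (n m s : nat) (U : 'M[C]_(n, m))
    (N : 'M[C]_m) (W : 'M[C]_(m, s.+1)) (z : C) : 'M[C]_(n, s.+1) :=
  U *m invmx (z%:M - N) *m W.

Definition residual (C : fieldType) (n s : nat) (A : 'M[C]_n)
    (B X : 'M[C]_(n, s.+1)) (z : C) : 'M[C]_(n, s.+1) :=
  B - (z%:M - A) *m X.

Definition block_charpoly (C : fieldType) (m s d : nat)
    (N : 'M[C]_m) (W : 'M[C]_(m, s.+1)) (P : {poly 'M[C]_s.+1}) : Prop :=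
  size P = d.+1 /\ mpoly_circ P N W = 0.

(* Main.v *)
Require Import Defs.
From mathcomp Require Import all_boot all_order all_algebra.
From mathcomp Require Import reals complex.

Import GRing.Theory Num.Theory.
Local Open Scope ring_scope.
Local Open Scope sesquilinear_scope.

(** Write [q = phi(A)^-1 B], [T = (Z^* U)^-1 Z^*] (so that [T U = 1] and
    [N = T A U] is the compression of [A]) and [y = T q].

    Two facts drive the proof.  First, [P |-> P(A) o q] maps the polynomials
    of degree below [j] onto the search space, on which [U T] is the identity,
    so pushing [A^i q] through [T] one power at a time gives
    [T (P(A) o q) = P(N) o y] for all [P] of degree at most [j]
    ([compressed_circ]).  In particular [W = T B = phi(N) y], and since
    [phi(N)] is injective, [Lam] annihilates [y] as well as [W].

    Second, by the same token the [j] blocks [N^i y] span the whole coordinate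
    space; as they form a square matrix they are also independent.  Hence a
    monic [Lam] of degree [j] that annihilates [y] divides, on the left and
    with a constant quotient, every annihilator of [y] of degree at most [j]
    ([annihilator_factor]).

    For a scalar polynomial [f], write [(z - N)^-1 f(N) y = P(N) o y] with
    [deg P < j].  Then [G = f - (z - X) P] annihilates [y], so [G = Lam g] for
    a constant [g], and evaluation at [z] gives [Lam(z) g = f(z)]
    ([resolvent_interpolation]).  Taking [f = 1] shows that [Lam(z)] is
    invertible.  Taking [f = phi] makes [U (P(N) o y) = P(A) o q] the
    Petrov-Galerkin approximation, so that the residual
    [phi(A) q - (z - A) (P(A) o q)] is [G(A) o q = (Lam(A) o q) g], where
    [g = phi(z) Lam(z)^-1]. *)

(** * The action of matrix polynomials on block vectors *)

Local Notation scalp s f := (map_poly (@scalar_mx _ s.+1) f).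

Lemma mpoly_circ_widen {F : fieldType} {m s : nat} (d : nat)
    (P : {poly 'M[F]_s.+1}) (N : 'M_m) (W : 'M_(m, s.+1)) :
  (size P <= d)%N -> mpoly_circ P N W = \sum_(i < d) N ^+ i *m W *m P`_i.
Proof.
move=> le_Pd; rewrite /mpoly_circ.
rewrite (big_ord_widen _ (fun i => N ^+ i *m W *m P`_i) le_Pd).
rewrite big_mkcond; apply: eq_bigr => i _; case: ltnP => // le_Pi.
by rewrite nth_default // mulmx0.
Qed.

(** Both sides are summed up to a common bound, because a difference can have
    smaller size than its terms; sums then follow from differences. *)
Lemma mpoly_circB {F : fieldType} {m s : nat} (P Q : {poly 'M[F]_s.+1})
    (N : 'M_m) (W : 'M_(m, s.+1)) :
  mpoly_circ (P - Q) N W = mpoly_circ P N W - mpoly_circ Q N W.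
Proof.
pose d := maxn (size P) (size Q).
rewrite !(mpoly_circ_widen d) ?leq_maxl ?leq_maxr //; last first.
  by rewrite (leq_trans (size_polyD _ _)) // size_polyN.
by rewrite -sumrB; apply: eq_bigr => i _; rewrite coefB mulmxBr.
Qed.

Lemma mpoly_circ0 {F : fieldType} {m s : nat} (N : 'M[F]_m)
    (W : 'M_(m, s.+1)) : mpoly_circ 0 N W = 0.
Proof. by rewrite -[0 in LHS](subrr 0) mpoly_circB subrr. Qed.

Lemma mpoly_circD {F : fieldType} {m s : nat} (P Q : {poly 'M[F]_s.+1})
    (N : 'M_m) (W : 'M_(m, s.+1)) :
  mpoly_circ (P + Q) N W = mpoly_circ P N W + mpoly_circ Q N W.
Proof.
by rewrite -[Q in LHS]opprK -[- Q]sub0r !mpoly_circB mpoly_circ0 sub0r opprK.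
Qed.

Lemma mpoly_circMC {F : fieldType} {m s : nat} (P : {poly 'M[F]_s.+1}) c
    (N : 'M_m) (W : 'M_(m, s.+1)) :
  mpoly_circ (P * c%:P) N W = mpoly_circ P N W *m c.
Proof.
rewrite !(mpoly_circ_widen (size P)) //; last first.
  by apply/leq_sizeP => i le_Pi; rewrite coefMC nth_default // mul0r.
by rewrite mulmx_suml; apply: eq_bigr => i _; rewrite coefMC; apply: mulmxA.
Qed.

Lemma mpoly_circC {F : fieldType} {m s : nat} (c : 'M[F]_s.+1)
    (N : 'M_m) (W : 'M_(m, s.+1)) : mpoly_circ c%:P N W = W *m c.
Proof.
rewrite (mpoly_circ_widen 1) ?size_polyC_leq1 // big_ord1 coefC eqxx.
by rewrite expr0 mul1mx.
Qed.

Lemma mpoly_circMX {F : fieldType} {m s : nat} (P : {poly 'M[F]_s.+1})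
    (N : 'M_m) (W : 'M_(m, s.+1)) :
  mpoly_circ (P * 'X) N W = N *m mpoly_circ P N W.
Proof.
rewrite (mpoly_circ_widen (size P).+1); last first.
  by have [-> | nzP] := eqVneq P 0; rewrite ?mul0r ?size_poly0 // size_mulX.
rewrite big_ord_recl coefMX eqxx mulmx0 add0r /mpoly_circ mulmx_sumr.
by apply: eq_bigr => i _; rewrite coefMX /= exprS !mulmxA.
Qed.

Lemma mpoly_circXn {F : fieldType} {m s : nat} (i : nat)
    (N : 'M[F]_m) (W : 'M_(m, s.+1)) : mpoly_circ 'X^i N W = N ^+ i *m W.
Proof.
elim: i => [|i IHi]; first by rewrite mpoly_circC mulmx1 expr0 mul1mx.
by rewrite exprSr mpoly_circMX IHi mulmxA exprS.
Qed.

Lemma scalpX_C {F : fieldType} {s : nat} (p : {poly F}) (c : F) :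
  scalp s (p * 'X + c%:P) = scalp s p * 'X + (c%:M)%:P.
Proof. by rewrite rmorphD rmorphM /= map_polyX map_polyC. Qed.

(** The coefficients of [scalp f] are scalar matrices, hence central: this is
    what lets scalar factors cross the noncommuting coefficients of [P]. *)
Lemma scalp_comm {F : fieldType} {s : nat} (f : {poly F})
    (P : {poly 'M[F]_s.+1}) : scalp s f * P = P * scalp s f.
Proof.
elim/poly_ind: f => [|f c IHf]; first by rewrite rmorph0 mul0r mulr0.
rewrite scalpX_C mulrDl mulrDr -mulrA -commr_polyX !mulrA IHf; congr (_ + _).
by apply/polyP => i; rewrite coefCM coefMC; apply/esym/scalar_mxC.
Qed.

Lemma mpoly_circ_scalpM {F : fieldType} {m s : nat} (f : {poly F})
    (P : {poly 'M[F]_s.+1}) (N : 'M_m) (W : 'M_(m, s.+1)) :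
  mpoly_circ P N (mpoly_circ (scalp s f) N W) = mpoly_circ (scalp s f * P) N W.
Proof.
elim/poly_ind: P => [|P c IHP]; first by rewrite mulr0 !mpoly_circ0.
rewrite mulrDr mulrA !mpoly_circD !mpoly_circMX !mpoly_circMC IHP.
by rewrite mpoly_circC.
Qed.

Lemma mpoly_circ_scalp {F : fieldType} {n s : nat} (f : {poly F})
    (A : 'M_n.+1) (W : 'M_(n.+1, s.+1)) :
  mpoly_circ (scalp s f) A W = horner_mx A f *m W.
Proof.
elim/poly_ind: f => [|f c IHf]; first by rewrite !rmorph0 mpoly_circ0 mul0mx.
rewrite scalpX_C mpoly_circD mpoly_circMX mpoly_circC IHf scalar_mxC.
rewrite rmorphD /= commr_polyX rmorphM /= horner_mx_X horner_mx_C.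
by rewrite mulmxDl -mulmxA.
Qed.

Lemma mpoly_circ_comm {F : fieldType} {m s : nat} (M N : 'M[F]_m)
    (P : {poly 'M_s.+1}) (W : 'M_(m, s.+1)) :
  M *m N = N *m M -> mpoly_circ P N (M *m W) = M *m mpoly_circ P N W.
Proof.
move=> MN; elim/poly_ind: P => [|P c IHP]; first by rewrite !mpoly_circ0 mulmx0.
rewrite !mpoly_circD !mpoly_circMX !mpoly_circC IHP mulmxDr !mulmxA.
by rewrite MN.
Qed.

Lemma mpoly_circMXsubC {F : fieldType} {m s : nat} (a : F)
    (P : {poly 'M[F]_s.+1}) (N : 'M_m) (W : 'M_(m, s.+1)) :
  mpoly_circ (P * ('X - (a%:M)%:P)) N W = (N - a%:M) *m mpoly_circ P N W.
Proof.
by rewrite mulrBr mpoly_circB mpoly_circMX mpoly_circMC mulmxBl scalar_mxC.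
Qed.

(** * The denominator polynomial *)

Lemma eigenvalueN_unitmx {F : fieldType} {m : nat} (N : 'M[F]_m) (a : F) :
  ~~ eigenvalue N a -> N - a%:M \in unitmx.
Proof. by rewrite /eigenvalue negbK /eigenspace kermx_eq0 row_free_unit. Qed.

Lemma size_phi {F : fieldType} {l : nat} (sigma : 'I_l -> option F) :
  (size (phi sigma) <= l.+1)%N.
Proof.
rewrite /phi; elim: l sigma => [|l IHl] sigma.
  by rewrite big_ord0 size_poly1.
rewrite big_ord_recr /= (leq_trans (size_polyMleq _ _)) //.
set p := \prod_(_ < _) _; set q := (X in (size p + size X)%N).
have le_p : (size p <= l.+1)%N := IHl (fun i => sigma (widen_ord (leqnSn l) i)).
have le_q : (size q <= 2)%N.
  by rewrite /q; case: (sigma _) => [a|]; rewrite ?size_XsubC ?size_poly1.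
by rewrite -subn1 leq_subLR add1n (leq_trans (leq_add le_p le_q)) ?addn2.
Qed.

Lemma horner_mx_phi_unit {F : fieldType} {n l : nat} (A : 'M[F]_n.+1)
    (sigma : 'I_l -> option F) :
  (forall i a, sigma i = Some a -> ~~ eigenvalue A a) ->
  horner_mx A (phi sigma) \in unitmx.
Proof.
move=> sigmaA; rewrite /phi.
apply: (big_ind (fun f => horner_mx A f \in unitmx)).
- by rewrite rmorph1 unitmx1.
- by move=> f g Af Ag; rewrite rmorphM /= unitmx_mul Af.
move=> i _; case Ei: (sigma i) => [a|]; last by rewrite rmorph1 unitmx1.
by rewrite rmorphB /= horner_mx_X horner_mx_C eigenvalueN_unitmx // (sigmaA i).
Qed.

(** [phi(N)] is a product of invertible factors [N - a], so it can be cancelled.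
    Working factor by factor avoids evaluating [phi] at [N], whose dimension
    [\sum_(k < d) s.+1] in the application is not syntactically a successor. *)
Lemma mpoly_circ_phi_inj {F : fieldType} {m s l : nat} (N : 'M[F]_m)
    (sigma : 'I_l -> option F) (P : {poly 'M[F]_s.+1}) (y : 'M_(m, s.+1)) :
  (forall i a, sigma i = Some a -> ~~ eigenvalue N a) ->
  mpoly_circ P N (mpoly_circ (scalp s (phi sigma)) N y) = 0 ->
  mpoly_circ P N y = 0.
Proof.
move=> sigmaN; rewrite mpoly_circ_scalpM /phi; move: P.
pose K (f : {poly F}) := forall P : {poly 'M_s.+1},
  mpoly_circ (scalp s f * P) N y = 0 -> mpoly_circ P N y = 0.
apply: (big_ind K) => [P|f g Kf Kg P|i _ P]; first by rewrite rmorph1 mul1r.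
  by rewrite rmorphM /= -mulrA => /Kf/Kg.
case Ei: (sigma i) => [a|]; last by rewrite rmorph1 mul1r.
rewrite scalp_comm rmorphB /= map_polyX map_polyC mpoly_circMXsubC => NP0.
have Nu := eigenvalueN_unitmx _ _ (sigmaN i a Ei).
by rewrite -[mpoly_circ _ _ _](mulKmx Nu) NP0 mulmx0.
Qed.

(** * Block vectors that generate the whole space *)

Definition block_krylov_full {F : fieldType} {s d : nat}
    (N : 'M[F]_(\sum_(k < d) s.+1)) (y : 'M[F]_(\sum_(k < d) s.+1, s.+1)) :=
  forall V, exists2 Q : {poly 'M_s.+1}, (size Q <= d)%N & V = mpoly_circ Q N y.

Lemma mpoly_circ_mxrow {F : fieldType} {s d m : nat} (N : 'M[F]_m)
    (y : 'M[F]_(m, s.+1)) (P : {poly 'M_s.+1}) :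
  (size P <= d)%N ->
  mpoly_circ P N y = \mxrow_(i < d) (N ^+ i *m y) *m \mxcol_(i < d) P`_i.
Proof. by move=> ?; rewrite mul_mxrow_mxcol -mpoly_circ_widen. Qed.

(** Spanning implies independence by dimension count: the block Krylov matrix
    with block columns [y], [N y], ..., [N^(d-1) y] is square. *)
Lemma krylov_inj {F : fieldType} {s d : nat} (N : 'M[F]_(\sum_(k < d) s.+1))
    (y : 'M[F]_(\sum_(k < d) s.+1, s.+1)) (P : {poly 'M_s.+1}) :
  block_krylov_full N y ->
  (size P <= d)%N -> mpoly_circ P N y = 0 -> P = 0.
Proof.
move=> surj leP; rewrite (mpoly_circ_mxrow _ _ _ leP); set K := \mxrow_i _.
have uK : K \in unitmx.
  rewrite -unitmx_tr -row_full_unit -sub1mx; apply/row_subP => k.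
  (* Only block vectors of width s.+1 are known to be in the range, so the
     k-th unit vector is padded with zero columns. *)
  have [Q leQ EQ] := surj (col k 1%:M *m delta_mx 0 0).
  have -> : row k 1%:M =
      delta_mx 0 0 *m (col k 1%:M *m delta_mx 0 0 : 'M[F]_(_, s.+1))^T.
    rewrite trmx_mul mulmxA trmx_delta mul_delta_mx tr_col trmx1.
    by rewrite [delta_mx _ _]mx11_scalar mxE !eqxx mul1mx.
  rewrite EQ (mpoly_circ_mxrow _ _ _ leQ) trmx_mul mulmxA.
  exact: submxMl.
move/(congr1 (mulmx (invmx K))); rewrite mulKmx // mulmx0 => P0.
apply/polyP => i; rewrite coef0; have [le_di | lt_id] := leqP d i.
  by rewrite nth_default // (leq_trans leP).
have := congr1 (fun M => submxcol M (Ordinal lt_id)) P0.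
by rewrite /= mxcolK /= submxcol0.
Qed.

(** Subtracting [Lam * G_d] from [G] cancels the term of degree [d], as [Lam] is
    monic, and leaves an annihilator of degree below [d], which vanishes.  The
    quotient stands on the right because [P(N) o W] is linear over right
    multiplication of [P] by constants. *)
Lemma annihilator_factor {F : fieldType} {s d : nat}
    (N : 'M[F]_(\sum_(k < d) s.+1)) (y : 'M[F]_(\sum_(k < d) s.+1, s.+1))
    (Lam G : {poly 'M_s.+1}) :
  block_krylov_full N y ->
  Lam \is monic -> block_charpoly d N y Lam ->
  (size G <= d.+1)%N -> mpoly_circ G N y = 0 ->
  G = Lam * (G`_d)%:P.
Proof.
move=> surj /monicP mon [szL L0] leG G0; apply/eqP.
rewrite -subr_eq0; apply/eqP.
apply: (krylov_inj N y) => //; last first.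
  by rewrite mpoly_circB mpoly_circMC L0 mul0mx G0 subrr.
apply/leq_sizeP => i; rewrite leq_eqVlt coefB coefMC => /predU1P[<- | lt_di].
  have -> : Lam`_d = 1 by rewrite -mon lead_coefE szL.
  by rewrite mul1r subrr.
rewrite [Lam`_i]nth_default ?szL // mul0r subr0.
by rewrite nth_default // (leq_trans leG).
Qed.

(** The resolvent applied to [f(N) y] is a polynomial in [N] acting on [y]; the
    defect [f - (z - X) P] annihilates [y], hence is a multiple of [Lam] whose
    constant quotient is read off at [z], where the term with [P] vanishes. *)
Lemma resolvent_interpolation {F : fieldType} {s d : nat}
    (N : 'M[F]_(\sum_(k < d) s.+1)) (y : 'M[F]_(\sum_(k < d) s.+1, s.+1))
    (Lam : {poly 'M_s.+1}) (f : {poly F}) (z : F) :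
  block_krylov_full N y ->
  Lam \is monic -> block_charpoly d N y Lam ->
  (size f <= d.+1)%N -> ~~ eigenvalue N z ->
  exists P : {poly 'M_s.+1}, exists g : 'M_s.+1,
    [/\ (size P <= d)%N,
        mpoly_circ P N y = invmx (z%:M - N) *m mpoly_circ (scalp s f) N y,
        scalp s f + P * ('X - (z%:M)%:P) = Lam * g%:P
      & Lam.[z%:M] *m g = (f.[z])%:M].
Proof.
move=> surj mon chL leF zN.
have [P leP EP] := surj (invmx (z%:M - N) *m mpoly_circ (scalp s f) N y).
set G := scalp s f + P * ('X - (z%:M)%:P).
have uN : z%:M - N \in unitmx.
  by rewrite -opprB -scaleN1r unitmxZ ?unitrN1 // eigenvalueN_unitmx.
have leG : (size G <= d.+1)%N.
  rewrite (leq_trans (size_polyD _ _)) // geq_max; apply/andP; split.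
    by rewrite (leq_trans (size_poly _ _)).
  rewrite (leq_trans (size_polyMleq _ _)) // size_XsubC addn2 /=.
  by rewrite ltnS.
have G0 : mpoly_circ G N y = 0.
  by rewrite mpoly_circD mpoly_circMXsubC -EP -opprB mulNmx mulKVmx ?subrr.
have EG := annihilator_factor _ _ _ _ surj mon chL leG G0.
exists P, G`_d; split=> //.
have := congr1 (horner^~ z%:M) EG.
rewrite /= hornerM_comm; last first.
  by rewrite /comm_poly hornerC; apply/esym/scalar_mxC.
rewrite hornerC -[_ *m _]/(_ * _) => <-.
rewrite hornerD horner_map /= hornerM_comm.
  by rewrite hornerXsubC subrr mulr0 addr0.
by rewrite /comm_poly hornerXsubC subrr mul0r mulr0.
Qed.

(** * Projection onto a rational Krylov space *)

(** Exactness of the compression.  Passing from [A^i q] to [A^(i+1) q] under [T]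
    only uses that [A^i q] is reproduced by [U T], which is why the identity
    holds one degree beyond the search space. *)
Lemma compressed_circ {F : fieldType} {n m s d : nat} (A : 'M[F]_n.+1)
    (T : 'M_(m, n.+1)) (U : 'M_(n.+1, m)) (q : 'M_(n.+1, s.+1))
    (P : {poly 'M_s.+1}) :
  (forall Q : {poly 'M_s.+1}, (size Q <= d)%N ->
     U *m (T *m mpoly_circ Q A q) = mpoly_circ Q A q) ->
  (size P <= d.+1)%N ->
  T *m mpoly_circ P A q = mpoly_circ P (T *m A *m U) (T *m q).
Proof.
move=> UT leP; set N := T *m A *m U.
have TA i : (i <= d)%N -> T *m (A ^+ i *m q) = N ^+ i *m (T *m q).
  elim: i => [|i IHi] le_id; first by rewrite !expr0 !mul1mx.
  have /UT : (size ('X^i : {poly 'M[F]_s.+1}) <= d)%N by rewrite size_polyXn.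
  rewrite !mpoly_circXn => UTi.
  by rewrite !exprS -!mulmxA -IHi ?(ltnW le_id) // -[in LHS]UTi /N !mulmxA.
rewrite !(mpoly_circ_widen _ _ _ _ leP) mulmx_sumr; apply: eq_bigr => i _.
by rewrite mulmxA TA // -ltnS.
Qed.

Lemma mxrow_blockE {F : fieldType} {n s d : nat} (U : 'I_d -> 'M[F]_(n, s.+1))
    (i : 'I_d) : \mxrow_(k < d) U k *m blockE F s d i = U i.
Proof.
rewrite mul_mxrow_mxcol (bigD1 i) //= eqxx mulmx1 big1 ?addr0 // => k neq_ki.
by rewrite val_eqE (negPf neq_ki) raddf0 mulmx0.
Qed.

(** The Petrov-Galerkin condition in algebraic form: a left inverse [T] of [U]
    makes [U T] the oblique projection onto the search space, and [T A U] the
    compression of [A].  The starting block [q = phi(A)^-1 B] is used instead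
    of [B] because it turns the rational space into a polynomial one. *)
Lemma projection_residual {F : fieldType} {n s j : nat} (hj : (0 < j)%N)
    (A : 'M[F]_n.+1) (B : 'M[F]_(n.+1, s.+1)) (sigma : 'I_j.-1 -> option F)
    (U : 'M[F]_(n.+1, \sum_(k < j) s.+1)) (T : 'M[F]_(\sum_(k < j) s.+1, n.+1))
    (N := T *m A *m U) (W : 'M[F]_(\sum_(k < j) s.+1, s.+1))
    (Lam : {poly 'M[F]_s.+1}) (z : F) :
  (forall i a, sigma i = Some a -> ~~ eigenvalue A a) ->
  (forall i a, sigma i = Some a -> ~~ eigenvalue N a) ->
  (forall V, in_block_RK j A B sigma V <-> exists K, V = U *m K) ->
  T *m U = 1%:M -> U *m W = B ->
  block_charpoly j N W Lam -> Lam \is monic -> ~~ eigenvalue N z ->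
  Lam.[z%:M] \in unitmx /\
  residual A B (pg_approx U N W z) z =
    (phi sigma).[z] *: (invmx (horner_mx A (phi sigma)) *m mpoly_circ Lam A B
                        *m invmx Lam.[z%:M]).
Proof.
move=> sigmaA sigmaN spanU TU UW [szL LW] mon zN.
set phiA := horner_mx A (phi sigma); pose q := invmx phiA *m B; pose y := T *m q.
have uA : phiA \in unitmx := horner_mx_phi_unit _ _ sigmaA.
have phiAC : invmx phiA *m A = A *m invmx phiA.
  have C : phiA *m A = A *m phiA by apply/esym/comm_mx_horner.
  by apply: (canRL (mulmxK uA)); rewrite -mulmxA -C mulKmx.
have circA P : mpoly_circ P A q = invmx phiA *m mpoly_circ P A B.
  exact: mpoly_circ_comm.
have UT (P : {poly 'M_s.+1}) :
  (size P <= j)%N -> U *m (T *m mpoly_circ P A q) = mpoly_circ P A q.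
  move=> leP; have [K ->] : exists K, mpoly_circ P A q = U *m K.
    by apply/spanU; exists P; rewrite circA.
  by rewrite (mulmxA T) TU mul1mx.
have TP (P : {poly 'M_s.+1}) :
  (size P <= j.+1)%N -> T *m mpoly_circ P A q = mpoly_circ P N y.
  exact: compressed_circ UT.
have surj : block_krylov_full N y.
  move=> V; have [P [leP EP]] : in_block_RK j A B sigma (U *m V).
    by apply/spanU; exists V.
  by exists P => //; rewrite -TP ?(leqW leP) // circA -EP mulmxA TU mul1mx.
have lephi : (size (phi sigma) <= j)%N.
  by rewrite (leq_trans (size_phi sigma)) ?prednK.
have phiq : mpoly_circ (scalp s (phi sigma)) A q = B.
  by rewrite mpoly_circ_scalp mulKVmx.
have Wy : W = mpoly_circ (scalp s (phi sigma)) N y.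
  rewrite -TP ?(leq_trans (size_poly _ _)) ?(leqW lephi) //.
  by rewrite phiq -UW mulmxA TU mul1mx.
have chL : block_charpoly j N y Lam.
  by split=> //; apply: (mpoly_circ_phi_inj _ _ _ _ sigmaN); rewrite -Wy.
(* The choice f = 1, rather than phi, also covers the zeros of phi. *)
have uL : Lam.[z%:M] \in unitmx.
  have [|P [g [_ _ _]]] := resolvent_interpolation _ _ _ 1 z surj mon chL _ zN.
    by rewrite size_poly1.
  by rewrite hornerC => /mulmx1_unit[].
split=> //.
have [|P [g [leP PN EG gz]]] :=
  resolvent_interpolation _ _ _ (phi sigma) z surj mon chL _ zN.
  exact: leqW.
have Eg : g = (phi sigma).[z] *: invmx Lam.[z%:M].
  by rewrite -[g](mulKmx uL) gz scalar_mxC mul_scalar_mx.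
rewrite scalemxAr -Eg -circA -mpoly_circMC -EG mpoly_circD mpoly_circMXsubC phiq.
rewrite -opprB mulNmx /residual /pg_approx -mulmxA [in X in invmx _ *m X]Wy -PN.
by rewrite -TP ?(leqW leP) // UT.
Qed.

Theorem theorem2p16 (R : realType) (n s j : nat) (hs : (1 < s.+1)%N)
  (hj : (0 < j)%N)
  (A : 'M[R[i]]_n.+1) (B : 'M[R[i]]_(n.+1, s.+1))
  (sigma : 'I_j.-1 -> option R[i])
  (hsigmaA : forall i a, sigma i = Some a -> ~~ eigenvalue A a)
  (U : 'I_j.+1 -> 'M[R[i]]_(n.+1, s.+1))
  (hUorth : orthonormal_cols (\mxrow_(i < j.+1) U i))
  (hspan_j : forall V : 'M[R[i]]_(n.+1, s.+1),
     in_block_RK j A B sigma V <-> in_block_span (firstblocks U) V)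
  (hspan_jS : forall V : 'M[R[i]]_(n.+1, s.+1),
     in_block_RK j.+1 A B sigma V <-> in_block_span U V)
  (RB : 'M[R[i]]_s.+1) (hRB : RB \in unitmx) (hB : B = U ord0 *m RB)
  (Z : 'M[R[i]]_(n.+1, \sum_(i < j) s.+1)) (hZorth : orthonormal_cols Z)
  (Uj := \mxrow_(i < j) firstblocks U i)
  (hZU : Z ^t* *m Uj \in unitmx)
  (Aj := compression A Uj Z)
  (hsigmaAj : forall i a, sigma i = Some a -> ~~ eigenvalue Aj a)
  (W := blockE R[i] s j 0 *m RB)
  (Lam : {poly 'M[R[i]]_s.+1})
  (hLam : block_charpoly j Aj W Lam) (hLam_monic : Lam \is monic) :
  forall z : R[i], ~~ eigenvalue Aj z ->
    Lam.[z%:M] \in unitmx /\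
    residual A B (pg_approx Uj Aj W z) z =
      (phi sigma).[z] *: (invmx (horner_mx A (phi sigma)) *m mpoly_circ Lam A B
                          *m invmx Lam.[z%:M]).
Proof.
move=> z zAj.
pose T := invmx (Z ^t* *m Uj) *m Z ^t*.
have EAj : Aj = T *m A *m Uj by rewrite /Aj /compression /T !mulmxA.
move: hsigmaAj hLam zAj; rewrite EAj => hsigmaN hLamN zN.
apply: projection_residual => //.
- move=> V; rewrite hspan_j; split=> [[K ->] | [K ->]].
    by exists (\mxcol_i K i); rewrite mul_mxrow_mxcol.
  exists (submxcol K); rewrite -[K in LHS]submxcolK.
  by rewrite mul_mxrow_mxcol.
- by rewrite /T -mulmxA mulVmx.
- rewrite /W mulmxA (mxrow_blockE _ (Ordinal hj)) hB; congr (U _ *m _).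
  exact: val_inj.
Qed.
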